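(* Consider the fairness-first system described in the context, operating under stability, with hot data arrival rate $\lambda$ and i.i.d. server service times distributed as $V$. For $i\ge0$ let $S_i$ be a random variable with $$\Pr\{S_i>s\}=\Pr\{V>s\}\bigl(1-\Pr\{V\le s\}^2\bigr)^i.$$ Then the hot data download time is bounded above by that of an $M/G/1$ queue with arrival rate $\lambda$ and service time distribution $S_{t-\log_2(t+1)}$, and bounded below by that of an $M/G/1$ queue with arrival rate $\lambda$ and service time distribution $S_t$; that is, the steady-state average hot data download time lies between the steady-state average response times of these two $M/G/1$ FIFO queues.
   Context: A data set consisting of one hot symbol and $k-1$ cold symbols is stored using a binary $[2^k-1,k]$ simplex code: each nonzero binary linear combination of the $k$ symbols is stored on its own server. For the hot symbol there is one systematic server and $t=2^{k-1}-1$ disjoint recovery groups of two servers each; exactly $\log_2(t+1)=k-1$ of these groups contain a cold data server (the systematic server of a cold symbol), one in each such group. Fairness-first system. Hot data requests arrive as a Poisson process of rate $\lambda$, and requests for each cold symbol arrive as independent Poisson processes of rate $\lambda_c$. Each request (hot or cold) is assigned to the systematic server of the symbol it asks for, where requests are served one at a time in FIFO order. As soon as a hot data request moves into service at its systematic server, a redundant copy of it is launched at each of its recovery groups that is idle at that moment (both servers start serving it); no copy is launched at non-idle groups. A redundant copy at a recovery group completes when both servers of the group finish serving it. If a cold data request arrives at a cold data server busy with a redundant hot data copy, that redundant copy is immediately removed from the system (from its recovery group). A hot data request completes as soon as its copy at the systematic server or one of its redundant copies at a recovery group completes, and its outstanding copies are then removed immediately. Service times at all servers are i.i.d., distributed as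 $V$. The download time is the time from arrival to completion. *)

(* Defs.v *)
From HB Require Import structures.
From mathcomp Require Import all_boot all_order all_algebra.
From mathcomp Require Import all_classical all_reals all_analysis measurable_realfun.

Set Implicit Arguments.
Unset Strict Implicit.
Unset Printing Implicit Defensive.

Import Order.TTheory GRing.Theory Num.Theory.
Import numFieldNormedType.Exports.

Local Open Scope classical_set_scope.
Local Open Scope ring_scope.

Section Laws.
Context d (T : measurableType d) (R : realType) (P : probability T R).
Local Open Scope ereal_scope.

Definition mutually_independent (I : eqType) (X : I -> {RV P >-> R}) : Prop :=
  forall (s : seq I) (B : I -> set R), uniq s ->
    (forall i, measurable (B i)) ->
    P [set w | forall i, i \in s -> B i (X i w)] =
    \prod_(i <- s) P (X i @^-1` B i).

Definition has_law (X : {RV P >-> R}) (mu : set R -> \bar R) : Prop :=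
  forall B, measurable B -> distribution P X B = mu B.

(* Convergence in law, with the limit living on the extended line so that mass
   may escape to infinity: an unstable queue then has limit law the Dirac mass
   at +oo, and infinite steady-state mean.  A limit law on [-oo, +oo] is
   determined by these limits at its continuity points, hence is unique. *)
Definition limit_law (Y : nat -> T -> R) (mu : probability (\bar R) R) : Prop :=
  forall x : R, mu [set x%:E] = 0 ->
    P [set w | (Y n w <= x)%R] @[n --> \oo] --> mu [set y | y <= x%:E].

Definition stable (Y : nat -> T -> R) : Prop :=
  exists mu, limit_law Y mu /\ mu [set y | y \is a fin_num] = 1.

Definition steady_state_mean (Y : nat -> T -> R) (m : \bar R) : Prop :=
  exists mu, limit_law Y mu /\ m = \int[mu]_y y.

End Laws.

Section Fifo.
Context (R : realType).

Definition arrival (a : nat -> R) (n : nat) : R := \sum_(i < n.+1) a i.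

(* Single FIFO server, empty at time 0.  [arr n] is the arrival epoch of
   request n, and [svc n b] its service time if its service begins at epoch b:
   request n+1 starts at the later of its arrival and the departure of n. *)
Fixpoint fifo_start (arr : nat -> R) (svc : nat -> R -> R) (n : nat) : R :=
  if n is m.+1 then
    let b := fifo_start arr svc m in Num.max (arr n) (b + svc m b)
  else arr 0%N.

Definition fifo_departure (arr : nat -> R) (svc : nat -> R -> R) (n : nat) : R :=
  let b := fifo_start arr svc n in b + svc n b.

Definition fifo_response (arr : nat -> R) (svc : nat -> R -> R) (n : nat) : R :=
  fifo_departure arr svc n - arr n.

End Fifo.

Section MG1.
Context d (T : measurableType d) (R : realType) (P : probability T R).

(* [A n] is the interarrival time preceding request n, [S n] its service time;
   the service time law is given by its tail s |-> Pr{S > s}. *)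
Definition MG1 (lambda : R) (tail : R -> \bar R)
    (A S : nat -> {RV P >-> R}) : Prop :=
  [/\ mutually_independent
        (fun i : nat + nat => match i with inl n => A n | inr n => S n end),
      forall n, has_law (A n) (exponential_prob lambda)
    & forall n s, P [set w | s < S n w] = tail s].

Definition MG1_response (A S : nat -> {RV P >-> R}) (n : nat) (w : T) : R :=
  fifo_response (arrival (fun i => A i w)) (fun i _ => S i w) n.

End MG1.

Definition S_tail (R : realType) (V : probability R R) (i : nat) (s : R) : \bar R :=
  (V `]s, +oo[%classic * (1 - V `]-oo, s]%classic ^+ 2) ^+ i)%E.

Section Simplex.
Context (k : nat).

(* A server is identified with the nonzero coefficient vector of the linear
   combination of the k symbols that it stores. *)
Definition server : finType := {v : 'rV['F_2]_k | v != 0}.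

Lemma delta_row_neq0 (j : 'I_k) : delta_mx 0 j != 0 :> 'rV['F_2]_k.
Proof. by apply/eqP => /rowP /(_ j) /eqP; rewrite !mxE !eqxx oner_eq0. Qed.

Definition systematic (j : 'I_k) : server := Sub (delta_mx 0 j) (delta_row_neq0 j).

Definition recovery_groups (hot : 'I_k) : {set {set server}} :=
  [set [set p.1; p.2] | p in [set p : server * server |
     val p.1 + val p.2 == val (systematic hot)]]%SET.

End Simplex.

(* One sample path.  For symbol j, [a j n] is the interarrival time preceding
   its n-th request and [s j n] the service time of that request at the
   systematic server of j; [c n v] is the service time, at server v, of the
   redundant copy of the n-th hot request (relevant only for v in a recovery
   group). *)
Section FairnessFirst.
Context (R : realType) (k : nat) (hot : 'I_k).
Context (a s : 'I_k -> nat -> R) (c : nat -> server k -> R).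

(* Redundant hot copies never delay cold requests, so a cold data server is a
   plain FIFO queue for the requests of its own symbol. *)
Definition cold_serving (j : 'I_k) (x : R) : Prop :=
  exists m, fifo_start (arrival (a j)) (fun n _ => s j n) m <= x
            < fifo_departure (arrival (a j)) (fun n _ => s j n) m.

(* When a hot request starts service at epoch b, all copies of the previous one
   are gone, so a recovery group can only be non-idle through cold requests. *)
Definition group_idle (b : R) (G : {set server k}) : Prop :=
  forall j, j != hot -> systematic j \in G -> ~ cold_serving j b.

(* Some cold request reaches the cold data server of G while that server would
   still be working on its part of the copy launched at epoch b.  An arrival
   after the completion of hot request n is harmless here: it can only discard a
   copy whose completion time exceeds the one already attained. *)
Definition copy_removed (n : nat) (b : R) (G : {set server k}) : Prop :=
  exists j m, [/\ j != hot, systematic j \in G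
    & b < arrival (a j) m < b + c n (systematic j)].

Definition copy_time (n : nat) (G : {set server k}) : R :=
  \big[Num.max/0]_(v in G) c n v.

Definition hot_service (n : nat) (b : R) : R :=
  \big[Num.min/s hot n]_(G in recovery_groups hot |
    `[< group_idle b G /\ ~ copy_removed n b G >]) copy_time n G.

Definition download_time (j : 'I_k) : nat -> R :=
  fifo_response (arrival (a j))
    (if j == hot then hot_service else fun n _ => s j n).

End FairnessFirst.

Section FairnessFirstLaw.
Context d (T : measurableType d) (R : realType) (P : probability T R).
Context (k : nat) (hot : 'I_k).

(* Poisson arrivals are encoded by their i.i.d. exponential interarrival times. *)
Definition fairness_first (lambda lambda_c : R) (V : probability R R)
    (A S : 'I_k -> nat -> {RV P >-> R}) (C : nat -> server k -> {RV P >-> R}) : Prop :=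
  [/\ mutually_independent
        (fun i : ('I_k * nat) + (('I_k * nat) + (nat * server k)) =>
           match i with
           | inl (j, n) => A j n
           | inr (inl (j, n)) => S j n
           | inr (inr (n, v)) => C n v
           end),
      forall j n, has_law (A j n)
        (exponential_prob (if j == hot then lambda else lambda_c)),
      forall j n, has_law (S j n) V
    & forall n v, has_law (C n v) V].

Definition ff_download (A S : 'I_k -> nat -> {RV P >-> R})
    (C : nat -> server k -> {RV P >-> R}) (j : 'I_k) (n : nat) (w : T) : R :=
  download_time hot (fun i m => A i m w) (fun i m => S i m w)
    (fun m v => C m v w) j n.

End FairnessFirstLaw.

(* Main.v *)
(* At every epoch the service time of hot request n is at least the minimum of
   its systematic copy and of the copies at all t recovery groups, and at most
   the minimum of its systematic copy and of the copies at the groups without a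
   cold data server, since those groups are always idle and never preempted.  As
   recovery groups are disjoint pairs of servers, these two minima form i.i.d.
   sequences, independent of the arrivals, with the laws of S_t and of
   S_(t - log2 (t+1)).  FIFO response times are monotone in the service times, so
   the hot download times lie pathwise between two M/G/1 response times.

   The law of the n-th M/G/1 response time does not change when the past is
   reversed (Loynes); the reversed response times increase with n, hence converge
   in law on [-oo, +oo] whether or not the queue is stable.  Finally the
   comparison of distribution functions passes to the limit at common continuity
   points, and to the means by the layer-cake formula. *)
Require Import Defs.
From HB Require Import structures.
From mathcomp Require Import all_boot all_order all_algebra.
From mathcomp Require Import all_classical all_reals all_analysis measurable_realfun.
From mathcomp Require Import lra zify.

Set Implicit Arguments.
Unset Strict Implicit.
Unset Printing Implicit Defensive.

Import Order.TTheory GRing.Theory Num.Theory.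
Import numFieldNormedType.Exports.

Local Open Scope classical_set_scope.
Local Open Scope ring_scope.

(** * Independence and joint laws *)

Lemma measurable_preimageT d (T : measurableType d) d' (T' : measurableType d')
  (f : T -> T') (B : set T') :
  measurable_fun setT f -> measurable B -> measurable (f @^-1` B).
Proof. by move=> mf mB; rewrite -[X in measurable X]setTI; exact: mf. Qed.

Lemma measurable_sublevel d (T : measurableType d) (R : realType)
  (f : T -> R) (x : R) :
  measurable_fun setT f -> measurable [set w | f w <= x].
Proof.
move=> mf; rewrite (_ : [set w | _] = f @^-1` `]-oo, x]).
  by apply: measurable_preimageT.
by apply/seteqP; split=> w /=; rewrite in_itv.
Qed.

Lemma measurable_superlevel d (T : measurableType d) (R : realType)
  (f : T -> R) (x : R) :
  measurable_fun setT f -> measurable [set w | x < f w].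
Proof.
move=> mf; rewrite (_ : [set w | _] = f @^-1` `]x, +oo[).
  by apply: measurable_preimageT.
by apply/seteqP; split=> w /=; rewrite in_itv/= andbT.
Qed.

(** As functions of [E], both sides are finite measures: [P] restricted to [F], and [P] scaled by
    [P F]. They agree on the pi-system [G], which contains the whole space, hence on the
    sigma-algebra it generates. *)
Lemma indep_g_sigma_algebra d (T : measurableType d) (R : realType)
  (P : probability T R) (G : set (set T)) (F : set T) :
  G `<=` measurable -> setI_closed G -> G setT -> measurable F ->
  (forall E, G E -> P (E `&` F) = P E * P F)%E ->
  forall E, <<s G >> E -> (P (E `&` F) = P E * P F)%E.
Proof.
move=> mG GI GT mF H E sE.
(* [mscale] takes a nonnegative real, so [P F] is first brought into that form. *)
have PF0 : 0 <= fine (P F) by rewrite fine_ge0.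
have PFE : (NngNum PF0)%:num%:E = P F.
  by rewrite [LHS]fineK// fin_num_measure.
have H1 := @g_sigma_algebra_measure_unique _ R T G mG (fun=> setT) (fun=> GT)
  (bigcup_const _ _) (mrestr P mF) (mscale (NngNum PF0) P) GI _ _ E sE.
rewrite muleC -PFE; apply: H1.
- by exists 0%N.
- by move=> A GA; apply: (etrans (H A GA)); rewrite muleC -[in LHS]PFE.
- move=> _; apply: (@le_lt_trans _ _ 1%E); last exact: ltry.
  by apply: probability_le1; exact: measurableI.
Qed.

Section Blocks.
Context d (T : measurableType d) (R : realType) (P : probability T R).
Context (I : eqType) (X : I -> {RV P >-> R}).

(** A pi-system generating the sigma-algebra of the variables indexed by [K]. Repetitions in [s] are
    allowed, so that intersections come from concatenating lists. *)
Definition cylinders (K : set I) : set (set T) :=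
  [set E | exists (s : seq I) (B : I -> set R),
    [/\ forall i, i \in s -> K i, forall i, measurable (B i)
      & E = [set w | forall i, i \in s -> B i (X i w)]]].

Lemma forall_seqE (J : eqType) (s : seq J) (E : J -> set T) :
  [set w | forall j, j \in s -> E j w] = \big[setI/setT]_(j <- s) E j.
Proof.
elim: s => [|j s IH]; first by rewrite big_nil; apply/seteqP; split.
rewrite big_cons -IH; apply/seteqP; split=> w /=.
  by move=> H; split=> [|i si]; apply: H; rewrite inE ?eqxx ?si ?orbT.
by move=> [Hj H] i; rewrite inE => /orP[/eqP ->//|]; exact: H.
Qed.

Lemma measurable_forall_seq (J : eqType) (s : seq J) (E : J -> set T) :
  (forall j, j \in s -> measurable (E j)) ->
  measurable [set w | forall j, j \in s -> E j w].
Proof.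
move=> mE; rewrite forall_seqE big_seq; apply: bigsetI_measurable => j; exact: mE.
Qed.

Lemma sub_cylinders (K K' : set I) :
  K `<=` K' -> cylinders K `<=` cylinders K'.
Proof. by move=> KK E [s [B [sK mB ->]]]; exists s, B; split=> // i /sK /KK. Qed.

Lemma cylinders_measurable (K : set I) : cylinders K `<=` measurable.
Proof.
move=> _ [s [B [_ mB ->]]].
apply: (@measurable_forall_seq _ s (fun j => X j @^-1` B j)) => j _.
exact: measurable_preimageT.
Qed.

Lemma cylinders_setT (K : set I) : cylinders K setT.
Proof. by exists [::], (fun=> setT); split=> //; apply/seteqP; split. Qed.

Lemma cylinders_setI (K : set I) : setI_closed (cylinders K).
Proof.
move=> _ _ [s [B [sK mB ->]]] [s' [B' [sK' mB' ->]]].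
exists (s ++ s'), (fun i => (if i \in s then B i else setT) `&`
                            (if i \in s' then B' i else setT)); split.
- by move=> i; rewrite mem_cat => /orP[/sK|/sK'].
- by move=> i; apply: measurableI; case: ifP.
apply/seteqP; split=> w /=.
  move=> [H H'] i _; split.
    by case: ifP => // /H.
  by case: ifP => // /H'.
move=> H; split=> i si; have := H i; rewrite mem_cat si ?orbT => /(_ isT) [];
  by [].
Qed.

Lemma cylinders_coord (K : set I) (i : I) (B : set R) :
  K i -> measurable B -> cylinders K (X i @^-1` B).
Proof.
move=> Ki mB; exists [:: i], (fun=> B); split => //.
  by move=> j; rewrite inE => /eqP ->.
by apply/seteqP; split=> w /= H; [move=> j; rewrite inE => /eqP ->|apply: H; rewrite inE].
Qed.

(** Lets the usual measurability lemmas show that an event depends only on the variables in [K]. *)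
Lemma measurable_coord (K : set I) (i : I) : K i ->
  measurable_fun (setT : set (g_sigma_algebraType (cylinders K))) (X i).
Proof.
move=> Ki _ B mB; rewrite setTI.
by apply: sub_sigma_algebra; exact: cylinders_coord.
Qed.

Hypothesis Xindep : mutually_independent X.

(** Once repetitions are removed, the two lists stay duplicate free when concatenated, because [K]
    and [K'] are disjoint; the product given by independence then splits in two. *)
Lemma indep_cylinders (K K' : set I) (E E' : set T) :
  K `&` K' = set0 -> cylinders K E -> cylinders K' E' ->
  P (E `&` E') = (P E * P E')%E.
Proof.
move=> KK' [s [B [sK mB ->]]] [s' [B' [sK' mB' ->]]].
have ue (u : seq I) (C : I -> set R) :
    [set w | forall i, i \in u -> C i (X i w)] =
    [set w | forall i, i \in undup u -> C i (X i w)].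
  by apply/seteqP; split=> w H i iu; apply: H; rewrite mem_undup in iu *.
have dj i : i \in s' -> i \in s -> False.
  by move=> /sK' Ki' /sK Ki; have : (K `&` K') i by []; rewrite KK'.
pose B'' i := if i \in s then B i else B' i.
have mB'' i : measurable (B'' i) by rewrite /B''; case: ifP.
rewrite (_ : _ `&` _ =
    [set w | forall i, i \in undup s ++ undup s' -> B'' i (X i w)]); last first.
  apply/seteqP; split=> w /=.
    move=> [H H'] i; rewrite mem_cat !mem_undup /B'' => /orP[si|si].
      by rewrite si; exact: H.
    by case: ifPn => [/dj//|_]; exact: H'.
  move=> H; split=> i si; have := H i; rewrite mem_cat !mem_undup si ?orbT.
    by move=> /(_ isT); rewrite /B'' si.
  by move=> /(_ isT); rewrite /B''; case: ifPn => // /dj.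
rewrite Xindep//; last first.
  rewrite cat_uniq !undup_uniq/= andbT; apply/hasPn => i.
  by rewrite !mem_undup => si'; apply/negP; exact: dj.
rewrite big_cat/= ue (ue s') !Xindep ?undup_uniq//.
congr (_ * _)%E; apply: eq_big_seq => i; rewrite mem_undup /B'' => si.
  by rewrite si.
by case: ifPn => // /dj.
Qed.

(** The pi-system argument is applied twice: with [E'] fixed in the generated sigma-algebra, then
    with the other event fixed as a cylinder. *)
Lemma indep_sigma_cylinders (K K' : set I) (E E' : set T) :
  K `&` K' = set0 -> <<s cylinders K >> E -> <<s cylinders K' >> E' ->
  P (E `&` E') = (P E * P E')%E.
Proof.
move=> KK' sE sE'.
have sm L : <<s cylinders L >> `<=` measurable.
  apply: smallest_sub; first exact: sigma_algebra_measurable.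
  exact: cylinders_measurable.
apply: (@indep_g_sigma_algebra _ _ _ _ (cylinders K)) => //.
- exact: cylinders_measurable.
- exact: cylinders_setI.
- exact: cylinders_setT.
- exact: sm sE'.
move=> F cF; rewrite setIC muleC.
apply: (@indep_g_sigma_algebra _ _ _ _ (cylinders K')) => //.
- exact: cylinders_measurable.
- exact: cylinders_setI.
- exact: cylinders_setT.
- exact: cylinders_measurable cF.
by move=> F' cF'; apply: (@indep_cylinders K' K) => //; rewrite setIC.
Qed.

(** Induction on [s]: the events of the tail are jointly measurable for the union [L] of their
    blocks, which is disjoint from the block of the head. *)
Lemma indep_blocks (J : eqType) (s : seq J) (K : J -> set I) (E : J -> set T) :
  uniq s -> {in s &, forall j j', j != j' -> K j `&` K j' = set0} ->
  {in s, forall j, <<s cylinders (K j) >> (E j)} ->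
  P [set w | forall j, j \in s -> E j w] = (\prod_(j <- s) P (E j))%E.
Proof.
elim: s => [_ _ _|j s IH /= /andP[js us] dK sE].
  rewrite big_nil -[RHS](probability_setT P); congr (P _).
  by apply/seteqP; split.
rewrite big_cons -IH//; last 2 first.
- by move=> a b as_ bs; apply: dK; rewrite inE ?as_ ?bs orbT.
- by move=> a as_; apply: sE; rewrite inE as_ orbT.
pose L := [set i | exists2 a, a \in s & K a i].
rewrite -(@indep_sigma_cylinders (K j) L).
- congr (P _); apply/seteqP; split=> w /=.
    by move=> H; split; [apply: H; rewrite inE eqxx|
      move=> a as_; apply: H; rewrite inE as_ orbT].
  by move=> [Hj H] a; rewrite inE => /orP[/eqP ->//|]; exact: H.
- rewrite -subset0 => i [Kj [a as_ Ka]].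
  rewrite -(dK j a)// ?inE ?eqxx ?as_ ?orbT//.
  by apply: contra js => /eqP ->.
- by apply: sE; rewrite inE eqxx.
rewrite forall_seqE big_seq.
apply: (@bigsetI_measurable _ (g_sigma_algebraType (cylinders L))) => a as_.
have : <<s cylinders (K a)>> (E a) by apply: sE; rewrite inE as_ orbT.
apply: sub_sigma_algebra2.
by apply: sub_cylinders => i Ki; exists a.
Qed.

End Blocks.

(** Used with [r] a time reversal. *)
Lemma mutually_independent_inv d (T : measurableType d) (R : realType)
  (P : probability T R) (I : eqType) (X : I -> {RV P >-> R}) (r : I -> I) :
  involutive r -> mutually_independent X ->
  mutually_independent (fun i => X (r i)).
Proof.
move=> rK iX s B us mB.
have := iX (map r s) (fun i => B (r i)); rewrite (map_inj_uniq (inv_inj rK)).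
move=> /(_ us (fun i => mB _)); rewrite big_map => H.
rewrite (_ : [set w | _] = [set w | forall i, i \in map r s -> B (r i) (X i w)]).
  by rewrite H; apply: eq_bigr => i _; rewrite rK.
apply/seteqP; split=> w /= Hw i.
  by move=> /mapP[j js ->]; rewrite rK; exact: Hw.
by move=> si; have := Hw (r i); rewrite rK; apply; apply: map_f.
Qed.

Section JointLaw.
Context (R : realType) (I : eqType).

Definition coord_cylinders : set (set (I -> R)) :=
  [set E | exists (s : seq I) (B : I -> set R),
    [/\ uniq s, forall i, measurable (B i)
      & E = [set x | forall i, i \in s -> B i (x i)]]].

(** The path space with its product sigma-algebra, on which families living on different probability
    spaces can be compared. *)
Definition sample_space := g_sigma_algebraType coord_cylinders.
HB.instance Definition _ := Measurable.on sample_space.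

Lemma measurable_sample_coord (i : I) :
  measurable_fun (setT : set sample_space) (fun x => x i).
Proof.
move=> _ B mB; rewrite setTI; apply: sub_sigma_algebra.
exists [:: i], (fun=> B); split => //.
by apply/seteqP; split=> w /= H; [move=> j; rewrite inE => /eqP ->|apply: H; rewrite inE].
Qed.

Lemma coord_cylinders_setI : setI_closed coord_cylinders.
Proof.
move=> _ _ [s [B [us mB ->]]] [s' [B' [us' mB' ->]]].
exists (undup (s ++ s')), (fun i => (if i \in s then B i else setT) `&`
                            (if i \in s' then B' i else setT)); split.
- exact: undup_uniq.
- by move=> i; apply: measurableI; case: ifP.
apply/seteqP; split=> w /=.
  move=> [H H'] i _; split.
    by case: ifP => // /H.
  by case: ifP => // /H'.
move=> H; split=> i si; have := H i; rewrite mem_undup mem_cat si ?orbT => /(_ isT) [];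
  by [].
Qed.

Lemma measurable_sample d (T : measurableType d) (X : I -> T -> R) :
  (forall i, measurable_fun setT (X i)) ->
  measurable_fun setT (fun w => X^~ w : sample_space).
Proof.
move=> mX; apply: (@measurability _ _ T sample_space setT (fun w => X^~ w) coord_cylinders) => //.
move=> _ [_ [s [B [us mB ->]]] <-]; rewrite setTI.
apply: (@measurable_forall_seq _ _ _ s (fun j => X j @^-1` B j)) => j _.
exact: measurable_preimageT.
Qed.

(** Independence expresses the image measure of a cylinder by the marginals, and the cylinders form
    a pi-system generating the product sigma-algebra. *)
Lemma joint_law d (T : measurableType d) (P : probability T R)
  (X : I -> {RV P >-> R}) d' (T' : measurableType d') (P' : probability T' R)
  (X' : I -> {RV P' >-> R}) :
  mutually_independent X -> mutually_independent X' ->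
  (forall i B, measurable B -> P (X i @^-1` B) = P' (X' i @^-1` B)) ->
  forall E : set sample_space, measurable E ->
    P [set w | E (fun i => X i w)] = P' [set w | E (fun i => X' i w)].
Proof.
move=> iX iX' XX' E mE.
have mX : measurable_fun setT (fun w => (fun i => X i w) : sample_space).
  exact: (@measurable_sample _ _ X).
have mX' : measurable_fun setT (fun w => (fun i => X' i w) : sample_space).
  exact: (@measurable_sample _ _ X').
have cT : coord_cylinders setT.
  by exists [::], (fun=> setT); split=> //; apply/seteqP; split.
have mC : coord_cylinders `<=` @measurable _ sample_space.
  exact: sub_sigma_algebra.
apply: (@g_sigma_algebra_measure_unique _ R sample_space coord_cylinders mC
  (fun=> setT) (fun=> cT) (bigcup_const _ _)
  (pushforward P (fun w => (fun i => X i w) : sample_space))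
  (pushforward P' (fun w => (fun i => X' i w) : sample_space))) => //.
- exact: coord_cylinders_setI.
- move=> _ [s [B [us mB ->]]].
  transitivity (\prod_(i <- s) P (X i @^-1` B i))%E; first exact: iX.
  apply: etrans (esym (iX' s B us mB)).
  by apply: eq_bigr => i _; exact: XX'.
- by move=> _; apply: (@le_lt_trans _ _ 1%E); [exact: (probability_le1 P measurableT)|exact: ltry].
Qed.

End JointLaw.

(** * FIFO and M/G/1 queues *)

Section FifoQueue.
Context (R : realType).
Implicit Types (arr a s : nat -> R) (svc : nat -> R -> R).

(** The epochs [b] and [b'] are unrelated in the hypothesis because the two systems start the same
    request at different times. *)
Lemma fifo_start_le arr svc svc' n :
  (forall i b b', svc i b <= svc' i b') ->
  fifo_start arr svc n <= fifo_start arr svc' n.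
Proof.
move=> H; elim: n => //= n IH.
by rewrite ge_max !le_max lexx/= lerD// orbT.
Qed.

Lemma fifo_response_le arr svc svc' n :
  (forall i b b', svc i b <= svc' i b') ->
  fifo_response arr svc n <= fifo_response arr svc' n.
Proof. by move=> H; rewrite lerB// lerD// fifo_start_le. Qed.

(** Lindley's recursion for the waiting time before service. *)
Fixpoint lindley a s n : R :=
  if n is m.+1 then Num.max 0 (lindley a s m + s m - a m.+1) else 0.

Lemma fifo_response_lindley a s n :
  fifo_response (arrival a) (fun i _ => s i) n = lindley a s n + s n.
Proof.
rewrite /fifo_response /fifo_departure addrAC; congr (_ + _).
elim: n => [|n IH] /=; first by rewrite subrr.
rewrite -IH addr_maxl subrr; congr Num.max.
have -> : arrival a n.+1 = arrival a n + a n.+1 by rewrite /arrival big_ord_recr.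
by lra.
Qed.

Lemma eq_lindley a s a' s' n :
  (forall i, (i <= n)%N -> a i = a' i) -> (forall i, (i < n)%N -> s i = s' i) ->
  lindley a s n = lindley a' s' n.
Proof.
elim: n => //= n IH aa ss.
by rewrite aa// ss// IH// => i i_n; [apply: aa; exact: leqW|apply: ss; exact: leqW].
Qed.

(** Without request 0, request 1 finds an empty system; with it, request 1 waits a nonnegative time.
    The recursion is monotone in the waiting time and preserves this order. *)
Lemma lindley_shift a s n :
  lindley (fun i => a i.+1) (fun i => s i.+1) n <= lindley a s n.+1.
Proof.
elim: n => [|n IH]; first by rewrite /= le_max lexx.
by rewrite ge_max le_max lexx/= [X in Num.max _ X]lock le_max -lock !lerD// orbT.
Qed.

End FifoQueue.

(** Open right rays are a pi-system generating the Borel sets. *)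
Lemma eq_law_of_tails d (T : measurableType d) d' (T' : measurableType d')
  (R : realType) (P : probability T R) (P' : probability T' R)
  (X : {RV P >-> R}) (X' : {RV P' >-> R}) :
  (forall x, P [set w | x < X w] = P' [set w | x < X' w]) ->
  forall B : set R, measurable B -> P (X @^-1` B) = P' (X' @^-1` B).
Proof.
move=> XX' B mB.
apply: (@measure_unique _ R R (@RGenOInfty.G R) (fun n => `](- n%:R), +oo[%classic)
  (@RGenOInfty.measurableE R) _ _ _ (distribution P X) (distribution P' X')) => //.
- move=> _ _ [x ->] [y ->]; exists (Num.max x y).
  by apply/seteqP; split=> z /=; rewrite !in_itv/= !andbT gt_max => /andP.
- by move=> n; exists (- n%:R).
- apply/seteqP; split=> // x _; exists (Num.bound `|x|) => //=.
  rewrite in_itv/= andbT ltrNl (le_lt_trans (ler_norm _))// normrN.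
  exact: archi_boundP.
- move=> _ [x ->]; rewrite /distribution /pushforward/=.
  have E (U : Type) (f : U -> R) : f @^-1` `]x, +oo[ = [set w | x < f w].
    by apply/seteqP; split=> w /=; rewrite in_itv/= andbT.
  by have := XX' x; rewrite -!E.
- by move=> k; apply: (@le_lt_trans _ _ 1%E); [exact: probability_le1|exact: ltry].
Qed.

Lemma measurable_lindley d (T : measurableType d) (R : realType)
  (a s : nat -> T -> R) n :
  (forall i, measurable_fun setT (a i)) -> (forall i, measurable_fun setT (s i)) ->
  measurable_fun setT (fun w => lindley (a^~ w) (s^~ w) n).
Proof.
move=> ma ms; elim: n => [|n IH] /=; first exact: measurable_cst.
apply: measurable_maxr; first exact: measurable_cst.
by apply: measurable_funB; [apply: measurable_funD|].
Qed.

(** * Limit law of the M/G/1 response time *)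

Section MG1Limit.
Context d (T : measurableType d) (R : realType) (P : probability T R).
Context (lambda : R) (tail : R -> \bar R).

(** The response is one fixed measurable function [F] of the path of interarrival and service times,
    so [joint_law] applies. This transports results between realizations of the same queue. *)
Lemma MG1_response_law d' (T' : measurableType d') (P' : probability T' R)
  (A S : nat -> {RV P >-> R}) (A' S' : nat -> {RV P' >-> R}) n (B : set R) :
  MG1 lambda tail A S -> MG1 lambda tail A' S' -> measurable B ->
  P [set w | B (MG1_response A S n w)] = P' [set w | B (MG1_response A' S' n w)].
Proof.
move=> [iX lA tS] [iX' lA' tS'] mB.
pose F (x : sample_space R (nat + nat)%type) :=
  lindley (fun i => x (inl i)) (fun i => x (inr i)) n + x (inr n).
have mF : measurable_fun setT F.
  apply: measurable_funD; last exact: measurable_sample_coord.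
  apply (@measurable_lindley _ (sample_space R (nat + nat)%type) R
    (fun i x => x (inl i)) (fun i x => x (inr i)));
    move=> i; exact: measurable_sample_coord.
have := @joint_law R _ _ _ P _ _ _ P' _ iX iX' _ (F @^-1` B) (measurable_preimageT mF mB).
rewrite /preimage/= /F/= => H.
under eq_set do rewrite /MG1_response fifo_response_lindley.
under [X in _ = P' X]eq_set do rewrite /MG1_response fifo_response_lindley.
apply: H; case=> i C mC.
  by have := lA i C mC; rewrite -(lA' i C mC).
by apply: eq_law_of_tails => // x; rewrite tS tS'.
Qed.

Variables (A S : nat -> {RV P >-> R}).
Hypothesis AS : MG1 lambda tail A S.

(** Indices beyond [n] are fixed, which makes the reversal an involution of all of [nat]. *)
Definition reverse_upto (n i : nat) := if (i <= n)%N then (n - i)%N else i.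

Lemma reverse_uptoK n : involutive (reverse_upto n).
Proof.
move=> i; rewrite /reverse_upto; have [ni|ni] := leqP i n.
  by rewrite leq_subr subKn.
by rewrite leqNgt ni.
Qed.

Lemma MG1_reverse n :
  MG1 lambda tail (fun i => A (reverse_upto n i)) (fun i => S (reverse_upto n i)).
Proof.
case: AS => iX lA tS; split=> [||i s]; [|by move=> i; exact: lA|exact: tS].
pose r (i : nat + nat) := match i with
  inl i => inl (reverse_upto n i) | inr i => inr (reverse_upto n i) end.
have rK : involutive r by case=> i; rewrite /r reverse_uptoK.
have := mutually_independent_inv rK iX.
by congr mutually_independent; apply/funext; case.
Qed.

(* Loynes' construction: the past is read backwards from request n, so that
   increasing n only adds requests in front of the same ones. *)
Definition reversed_response n w :=
  lindley (fun i => A (n - i)%N w) (fun i => S (n - i)%N w) n + S 0 w.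

(** The reversed data again drive an M/G/1 queue with the same parameters, and the response of
    request [n] reads only indices up to [n], where the involution is [n - i]. *)
Lemma reversed_response_law n (B : set R) : measurable B ->
  P [set w | B (MG1_response A S n w)] = P [set w | B (reversed_response n w)].
Proof.
move=> mB; rewrite (MG1_response_law n AS (MG1_reverse n) mB).
congr (P _); apply/funext => w; congr B.
rewrite /MG1_response fifo_response_lindley /reversed_response /reverse_upto.
rewrite leqnn subnn; congr (_ + _).
by apply: eq_lindley => i i_n; rewrite ?(ltnW i_n) ?i_n.
Qed.

Lemma reversed_response_nondecreasing w :
  nondecreasing_seq (reversed_response^~ w).
Proof.
apply/nondecreasing_seqP => n; rewrite lerD2r.
apply: le_trans (lindley_shift _ _ _).
by under [in leRHS]eq_fun do rewrite subSS.
Qed.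

Lemma measurable_reversed_response n : measurable_fun setT (reversed_response n).
Proof.
apply: measurable_funD => //.
exact: (@measurable_lindley _ _ _ (fun i w => A (n - i)%N w) (fun i w => S (n - i)%N w)).
Qed.

(** The limit is the law of the pathwise supremum of the reversed responses. Their sublevel events
    decrease to that of the supremum, so continuity from above gives convergence at every [x]. *)
Lemma MG1_response_cvg : exists mu : probability (\bar R) R, forall x : R,
  P [set w | MG1_response A S n w <= x] @[n --> \oo] --> mu [set y | (y <= x%:E)%E].
Proof.
(* The supremum is taken in the extended line: paths with unbounded reversed responses contribute
   mass at [+oo]. *)
pose Z w := esups (fun n => (reversed_response n w)%:E) 0.
have mZ : measurable_fun setT Z.
  apply: (@measurable_fun_esups _ _ _ _ (fun n w => (reversed_response n w)%:E)) => n.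
  by apply/measurable_EFinP; exact: measurable_reversed_response.
pose ZZ : {RV P >-> \bar R} := mfun_Sub (mem_set mZ).
exists (distribution P ZZ) => x.
have E : distribution P ZZ [set y | (y <= x%:E)%E] =
    P (\bigcap_n [set w | reversed_response n w <= x]).
  congr (P _).
  apply/seteqP; split=> w /=.
    move=> Zx n _ /=; rewrite -lee_fin; apply: le_trans Zx.
    by apply: ereal_sup_ubound; exists n.
  by move=> H; apply: ge_ereal_sup => _ [n _ <-]; rewrite lee_fin; exact: H.
suff : P [set w | MG1_response A S n w <= x] @[n --> \oo] -->
    P (\bigcap_n [set w | reversed_response n w <= x]) by rewrite -E.
have mr n : measurable [set w | reversed_response n w <= x].
  by apply: measurable_sublevel; exact: measurable_reversed_response.
rewrite (_ : (fun n => P _) = P \o (fun n => [set w | reversed_response n w <= x])).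
  apply: nonincreasing_cvg_mu => //.
  - by rewrite (le_lt_trans (probability_le1 _ _))// ltry.
  - exact: bigcapT_measurable.
  move=> m n mn; apply/subsetPset => w /=; apply: le_trans.
  exact: reversed_response_nondecreasing.
apply/funext => n /=.
apply: (@reversed_response_law n [set y | y <= x]).
by apply: measurable_sublevel; exact: measurable_id.
Qed.

End MG1Limit.

(** * Stochastic order on the extended line *)

Section LayerCake.
Context d (T : measurableType d) (R : realType) (P : probability T R).
Context (f : T -> \bar R) (mf : measurable_fun setT f).
Local Open Scope ereal_scope.

(** The region between the axis and the graph of [f]. *)
Let below : set (T * measurableTypeR R) :=
  [set p | (0 <= p.2)%R /\ p.2%:E < f p.1].

Let mbelow : measurable below.
Proof.
rewrite (_ : below = (fun p => (0 <= p.2)%R && (p.2%:E < f p.1)) @^-1` [set true]).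
  apply: measurable_preimageT => //; apply: measurable_and.
    exact: measurable_fun_ler.
  apply: measurable_fun_lte; first by apply/measurable_EFinP.
  exact: (measurableT_comp mf).
by apply/seteqP; split=> p /= /andP.
Qed.

Let ysection_below r : ysection below r = [set w | (0 <= r)%R /\ r%:E < f w].
Proof. by apply/seteqP; split=> w; rewrite /ysection/= inE. Qed.

Lemma measurable_tail :
  measurable_fun (setT : set (measurableTypeR R))
    (fun r => P [set w | (0 <= r)%R /\ r%:E < f w]).
Proof.
have := measurable_fun_ysection P mbelow; congr (measurable_fun _ _).
by apply/funext => r /=; rewrite ysection_below.
Qed.

(** Tonelli on [below]: the slice over [w] has length [f^\+ w], and the slice at height [r] is a
    tail event. *)
Lemma integral_funepos_tail :
  \int[P]_w f^\+ w =
  \int[lebesgue_measure]_r P [set w | (0 <= r)%R /\ r%:E < f w].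
Proof.
transitivity (\int[P]_w (lebesgue_measure \o xsection below) w).
  apply: eq_integral => w _ /=; rewrite funeposE.
  have -> : xsection below w = [set r : R | (0 <= r)%R /\ r%:E < f w].
    by apply/seteqP; split=> r; rewrite /xsection/= inE.
  case: (f w) => [x| |]/=.
  - rewrite (_ : [set r | _] = `[0%R, x[%classic); last first.
      by apply/seteqP; split=> r /=; rewrite in_itv/= lte_fin => /andP.
    rewrite lebesgue_measure_itv/= lte_fin oppr0 adde0.
    by have [x0|x0] := ltP 0%R x; [rewrite max_l// lee_fin ltW|rewrite max_r// lee_fin].
  - rewrite (_ : [set r | _] = `[0%R, +oo[%classic); last first.
      apply/seteqP; split=> r /=; rewrite in_itv/= ?andbT ?ltry; first by case.
      by split.
    by rewrite lebesgue_measure_itv/= ltry max_l ?leey// oppr0 adde0.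
  - rewrite (_ : [set r | _] = set0) ?measure0 ?max_r ?leNye//.
    by apply/seteqP; split=> r //= []; rewrite ltNge leNye.
transitivity (\int[lebesgue_measure]_r (P \o ysection below) r); last first.
  by apply: eq_integral => r _ /=; rewrite ysection_below.
have := indic_fubini_tonelli P (@lebesgue_measure R) mbelow.
by rewrite indic_fubini_tonelli_FE// indic_fubini_tonelli_GE.
Qed.

End LayerCake.

Lemma le_integral_funepos d (T : measurableType d) d' (T' : measurableType d')
  (R : realType) (P : probability T R) (P' : probability T' R)
  (f : T -> \bar R) (f' : T' -> \bar R) :
  measurable_fun setT f -> measurable_fun setT f' ->
  (forall r, 0 <= r -> (P [set w | r%:E < f w] <= P' [set w | r%:E < f' w])%E) ->
  (\int[P]_w f^\+ w <= \int[P']_w f'^\+ w)%E.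
Proof.
move=> mf mf' ff'; rewrite !integral_funepos_tail//.
apply: ge0_le_integral => //; try exact: measurable_tail.
move=> r _; have [r0|r0] := leP 0 r.
  have E (U : Type) (g : U -> \bar R) :
    [set w | true /\ (r%:E < g w)%E] = [set w | (r%:E < g w)%E].
    by apply/seteqP; split=> w //= [].
  by rewrite !E; exact: ff'.
(* At negative heights both slices are empty. *)
have E (U : Type) (g : U -> \bar R) :
  [set w | false /\ (r%:E < g w)%E] = set0.
  by apply/seteqP; split=> w //= [].
by rewrite !E !measure0.
Qed.

Section StochasticOrder.
Context (R : realType).
Local Open Scope ereal_scope.
Implicit Types mu nu : probability (\bar R) R.

Lemma measurable_lee (x : \bar R) : measurable [set y : \bar R | y <= x].
Proof.
by have := @emeasurable_fun_infty_c _ _ R setT id measurableT (@measurable_id _ _ _) x; rewrite setTI.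
Qed.

Lemma cvg_cdf_right mu (x : R) :
  mu [set y | y <= (x + n.+1%:R^-1)%:E] @[n --> \oo] --> mu [set y | y <= x%:E].
Proof.
rewrite (_ : [set y | y <= x%:E] = \bigcap_n [set y | y <= (x + n.+1%:R^-1)%:E]).
  apply: (@nonincreasing_cvg_mu _ _ _ mu (fun n => [set y | y <= (x + n.+1%:R^-1)%:E])).
  - by rewrite (le_lt_trans (probability_le1 _ _))// ?ltry//; exact: measurable_lee.
  - by move=> n; exact: measurable_lee.
  - by apply: bigcapT_measurable => n; exact: measurable_lee.
  move=> m n mn; apply/subsetPset => y /= /le_trans; apply.
  by rewrite lee_fin lerD2l lef_pV2 ?posrE// ler_nat.
apply/seteqP; split=> y /=.
  by move=> yx n _ /=; rewrite (le_trans yx)// lee_fin lerDl.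
case: y => [y| |] H.
- rewrite lee_fin leNgt; apply/negP => /ltr_add_invr[n].
  by rewrite ltNge -lee_fin H.
- by have := H 0%N I; rewrite /= leNgt ltry.
- by rewrite leNye.
Qed.

Lemma cvg_cdf_left mu (x : R) :
  mu [set y | y <= (x - n.+1%:R^-1)%:E] @[n --> \oo] --> mu [set y | y < x%:E].
Proof.
rewrite (_ : [set y | y < x%:E] = \bigcup_n [set y | y <= (x - n.+1%:R^-1)%:E]).
  apply: (@nondecreasing_cvg_mu _ _ _ mu (fun n => [set y | y <= (x - n.+1%:R^-1)%:E])).
  - by move=> n; exact: measurable_lee.
  - by apply: bigcupT_measurable => n; exact: measurable_lee.
  move=> m n mn; apply/subsetPset => y /= /le_trans; apply.
  by rewrite lee_fin lerD2l lerN2 lef_pV2 ?posrE// ler_nat.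
apply/seteqP; split=> y /=.
  case: y => [y| |].
  - rewrite lte_fin => /ltr_add_invr[n yx].
    by exists n => //=; rewrite lee_fin lerBrDr ltW.
  - by rewrite ltNge leey.
  - by move=> _; exists 0%N => //=; rewrite leNye.
by move=> [n _ /= /le_lt_trans]; apply; rewrite lte_fin ltrBlDr ltrDl.
Qed.

(** Every real atom of [mu] is an atom of the real variable [fine]. Only this inclusion is claimed,
    since [fine] also sends both infinities to 0. *)
Lemma countable_atoms mu : countable [set z : R | mu [set z%:E] != 0].
Proof.
pose X : {RV mu >-> R} := mfun_Sub (mem_set (fine_measurable measurableT)).
apply: sub_countable (pmf_gt0_countable X); apply: subset_card_le => z /= atom.
rewrite lt_neqAle pmf_ge0 andbT; apply: contra atom => /eqP/esym pz.
have mz : measurable (X @^-1` [set z]) by exact: measurable_preimageT.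
rewrite eq_le measure_ge0 andbT.
rewrite (_ : 0 = mu (X @^-1` [set z])); last first.
  by rewrite -(fineK (fin_num_measure mu _ mz)) -/(pmf X z) pz.
by apply: le_measure; rewrite ?inE// => _ ->.
Qed.

(** Otherwise the interval would be covered by two countable sets of atoms and have Lebesgue measure
    zero. *)
Lemma common_continuity_point mu nu (x y : R) : (x < y)%R ->
  exists z, [/\ (x < z < y)%R, mu [set z%:E] = 0 & nu [set z%:E] = 0].
Proof.
move=> xy; apply: contrapT => H.
have : lebesgue_measure `]x, y[%classic = 0 :> \bar R.
  apply: countable_lebesgue_measure0.
  apply: sub_countable (bigcup_countable (D := setT)
    (F := fun b : bool => [set z : R | (if b then mu else nu) [set z%:E] != 0]) _ _) => //.
    apply: subset_card_le => z /=; rewrite in_itv/= => xzy; apply: contrapT => Hz.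
    apply: H; exists z; split=> //; apply/eqP; apply/negPn/negP => atom; apply: Hz.
      by exists true.
    by exists false.
  by move=> b _; case: b; exact: countable_atoms.
rewrite lebesgue_measure_itv/= lte_fin xy => /eqP.
by rewrite -EFinD eqe subr_eq0 gt_eqF.
Qed.

(** Choose [z] between [x] and [x + n.+1%:R^-1], and let [n] grow: the distribution function of [nu]
    is right continuous. *)
Lemma cdf_le_of_dense mu nu :
  (forall x y : R, (x < y)%R -> exists2 z, (x < z < y)%R &
    mu [set u | u <= z%:E] <= nu [set u | u <= z%:E]) ->
  forall x : R, mu [set u | u <= x%:E] <= nu [set u | u <= x%:E].
Proof.
move=> H x; apply: (cvge_ge _ (@cvg_cdf_right nu x)); apply: nearW => n.
have [|z /andP[xz zn] muz] := H x (x + n.+1%:R^-1)%R; first by rewrite ltrDl.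
apply: le_trans (le_trans muz _); apply: le_measure; rewrite ?inE;
  try exact: measurable_lee.
- by move=> u /= /le_trans; apply; rewrite lee_fin ltW.
- by move=> u /= /le_trans; apply; rewrite lee_fin ltW.
Qed.

Lemma le_integral_cdf mu nu :
  (forall x : R, nu [set y | y <= x%:E] <= mu [set y | y <= x%:E]) ->
  \int[mu]_y y <= \int[nu]_y y.
Proof.
move=> H; rewrite [leLHS]integralE [leRHS]integralE; apply: leeB.
  apply: le_integral_funepos => // r _.
  have E : [set y : \bar R | r%:E < y] = ~` [set y | y <= r%:E].
    by apply/seteqP; split=> y /=; rewrite ltNge => /negP.
  by rewrite E !probability_setC ?leeB//; exact: measurable_lee.
(* The negative part is the positive part of [- y]. Its tails are events [y < - r] with a strict
   inequality, hence reached as left limits of distribution functions. *)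
rewrite -!funeposN; apply: le_integral_funepos.
- exact: measurableT_comp.
- exact: measurableT_comp.
move=> r _; rewrite /=.
have E : [set y : \bar R | r%:E < - y] = [set y | y < (- r)%:E].
  by apply/seteqP; split=> y /=; rewrite EFinN lteNr.
rewrite !E; apply: (cvge_le _ (@cvg_cdf_left nu (- r))); apply: nearW => n.
apply: le_trans (H _) _; apply: le_measure; rewrite ?inE//.
- exact: measurable_lee.
- have := @emeasurable_fun_infty_o _ _ R setT id measurableT (@measurable_id _ _ _) (- r)%:E.
  by rewrite setTI.
by move=> y /= /le_lt_trans; apply; rewrite lte_fin ltrBlDr ltrDl.
Qed.

End StochasticOrder.

(** * Recovery groups *)

Section RecoveryGroups.
Context (k : nat) (hot : 'I_k).
Implicit Types (G : {set server k}) (v u : server k).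

Lemma F2_addrr (v : 'rV['F_2]_k) : v + v = 0.
Proof.
rewrite -mulr2n -scaler_nat (_ : 2%:R = 0 :> 'F_2) ?scale0r//; exact/val_inj.
Qed.

(** The two servers are automatically distinct: in characteristic 2, equal ones would sum to zero,
    which is not the vector of a server. *)
Lemma recovery_groupP G :
  reflect (exists v u, [/\ G = [set v; u]%SET, v != u
             & val v + val u = val (systematic hot)])
          (G \in recovery_groups hot).
Proof.
apply: (iffP imsetP) => [[[v u]]|[v [u [-> _ vu]]]].
  rewrite inE/= => /eqP vu ->; exists v, u; split => //.
  apply: contra_eq_neq vu => ->; rewrite F2_addrr eq_sym.
  exact: valP (systematic hot).
by exists (v, u) => //; rewrite inE/= vu.
Qed.

Lemma recovery_groups_add G v u : G \in recovery_groups hot ->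
  v \in G -> u \in G -> v != u -> val v + val u = val (systematic hot).
Proof.
move=> /recovery_groupP[a [b [-> ab E]]]; rewrite !inE.
by move=> /orP[]/eqP-> /orP[]/eqP->; rewrite ?eqxx// 1?addrC.
Qed.

Lemma card_recovery_group G : G \in recovery_groups hot -> #|G| = 2%N.
Proof. by move=> /recovery_groupP[v [u [-> vu _]]]; rewrite cards2 vu. Qed.

(** A member [v] of a group determines its partner, the difference of the hot unit vector and [v];
    so two groups sharing [v] contain each other. *)
Lemma recovery_groups_trivIset : finset.trivIset (recovery_groups hot).
Proof.
apply/finset.trivIsetP => G G' GP GP'; apply: contraR => /pred0Pn[v /andP[/= vG vG']].
have sub (H H' : {set server k}) : H \in recovery_groups hot ->
    H' \in recovery_groups hot -> v \in H -> v \in H' -> H \subset H'.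
  move=> HP HP' vH vH'; apply/fintype.subsetP => u uH.
  have [<-//|uv] := eqVneq v u.
  have E := recovery_groups_add HP vH uH uv.
  have /recovery_groupP[a [b [HE ab E']]] := HP'.
  move: vH'; rewrite HE !inE => /orP[]/eqP va; apply/orP; [right|left];
    apply/eqP/val_inj/(addrI (val v)); rewrite E -E' va //.
  by rewrite addrC.
by rewrite finset.eqEsubset !sub.
Qed.

(** The partner of [v] is [v] plus the hot unit vector, nonzero exactly when [v] is not the hot
    systematic server. *)
Lemma cover_recovery_groups : finset.cover (recovery_groups hot) = [set~ systematic hot]%SET.
Proof.
apply/setP => v; rewrite !inE; apply/finset.bigcupP/idP => [[G GP vG]|vh].
  have /recovery_groupP[a [b [GE ab E]]] := GP.
  move: vG; rewrite GE !inE => /orP[]/eqP ->; apply/eqP => /(congr1 val) vE;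
  move: E; rewrite -vE => /eqP.
    by rewrite -subr_eq0 addrAC subrr add0r (negbTE (valP b)).
  by rewrite -subr_eq0 addrK (negbTE (valP a)).
have nz : val v + val (systematic hot) != 0.
  apply: contra vh => /eqP /(congr1 (fun x => x + val (systematic hot))).
  by rewrite -addrA F2_addrr addr0 add0r => /val_inj ->.
pose u : server k := Sub (val v + val (systematic hot)) nz.
exists [set v; u]%SET; last by rewrite !inE eqxx.
apply/imsetP; exists (v, u) => //.
by rewrite inE/= addrA F2_addrr add0r.
Qed.

Lemma card_server : #|{: server k}| = (2 ^ k - 1)%N.
Proof.
have := cardC (pred1 (0 : 'rV['F_2]_k)); rewrite card1 card_mx card_Fp// mul1n => <-.
by rewrite card_sig addKn; apply: eq_card.
Qed.

(** Disjoint pairs cover all servers but one, so twice their number is [2 ^ k - 2]. *)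
Lemma card_recovery_groups : #|recovery_groups hot| = (2 ^ (k - 1) - 1)%N.
Proof.
have /eqP := recovery_groups_trivIset.
rewrite cover_recovery_groups cardsC1 card_server.
under eq_bigr => G GP do rewrite (card_recovery_group GP).
rewrite sum_nat_const => E.
have k0 : (0 < k)%N by apply: leq_ltn_trans (ltn_ord hot).
have : (2 ^ k = 2 ^ (k - 1) * 2)%N by rewrite -expnSr subn1 prednK.
have : (0 < 2 ^ (k - 1))%N by rewrite expn_gt0.
lia.
Qed.

(* A group without cold data server is always idle at the start of a hot
   service, and never loses its copy. *)
Definition pure_groups : {set {set server k}} :=
  [set G in recovery_groups hot |
    [forall j, (j != hot) ==> (systematic j \notin G)]]%SET.

Lemma systematic_inj : injective (@systematic k).
Proof.
move=> i j /(congr1 val)/= /rowP/(_ i); rewrite !mxE !eqxx/=.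
by case: eqP.
Qed.

(** The mixed groups are the blocks of the [k - 1] cold data servers. Two of these servers never
    share a block: the sum of two cold unit vectors vanishes at coordinate [hot]. *)
Lemma card_mixed_groups : #|recovery_groups hot :\: pure_groups| = (k - 1)%N.
Proof.
have cov j : j != hot -> systematic j \in finset.cover (recovery_groups hot).
  by rewrite cover_recovery_groups !inE (inj_eq systematic_inj).
rewrite (_ : _ :\: _ =
    [set finset.pblock (recovery_groups hot) (systematic j) | j in [set~ hot]]%SET).
  rewrite card_in_imset; first by rewrite cardsC1 card_ord subn1.
  move=> i j; rewrite !inE => ih jh E; apply/eqP; apply: contraT => ij.
  have iG : systematic i \in finset.pblock (recovery_groups hot) (systematic i).
    by rewrite finset.mem_pblock cov.
  have jG : systematic j \in finset.pblock (recovery_groups hot) (systematic i).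
    by rewrite E finset.mem_pblock cov.
  have := recovery_groups_add (finset.pblock_mem (cov _ ih)) iG jG.
  rewrite (inj_eq systematic_inj) => /(_ ij) /rowP/(_ hot).
  by rewrite !mxE !eqxx/= ![hot == _]eq_sym (negbTE ih) (negbTE jh).
apply/setP => G; rewrite !inE; apply/andP/imsetP.
  move=> [nG GP]; move: nG; rewrite GP/= negb_forall => /existsP[j].
  rewrite negb_imply negbK => /andP[jh jG]; exists j; first by rewrite !inE.
  by rewrite (finset.def_pblock recovery_groups_trivIset GP jG).
move=> [j]; rewrite !inE => jh ->; have GP := finset.pblock_mem (cov _ jh).
split=> //; rewrite GP/= negb_forall; apply/existsP; exists j.
by rewrite jh/= negbK finset.mem_pblock cov.
Qed.

Lemma card_pure_groups (t : nat) : t = (2 ^ (k - 1) - 1)%N ->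
  #|pure_groups| = (t - trunc_log 2 (t + 1))%N.
Proof.
(* Here [t + 1] is the exact power [2 ^ (k - 1)], so the truncated logarithm is [k - 1]. *)
move=> ->; rewrite subnK ?expn_gt0// trunc_expnK//.
have := cardsD (recovery_groups hot) pure_groups.
rewrite card_mixed_groups card_recovery_groups.
rewrite (finset.setIidPr _); last by apply/fintype.subsetP => G; rewrite inE => /andP[].
have := subset_leq_card (_ : pure_groups \subset recovery_groups hot).
rewrite card_recovery_groups => /(_ _)/wrap[].
  by apply/fintype.subsetP => G; rewrite inE => /andP[].
lia.
Qed.

End RecoveryGroups.

(** * The fairness-first system *)

Section MeasurableBigop.
Context d (T : measurableType d) (R : realType) (J : Type) (r : seq J).
Context (q : pred J) (f : J -> T -> R).
Hypothesis mf : forall i, q i -> measurable_fun setT (f i).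

Lemma measurable_bigmaxr (x : R) :
  measurable_fun setT (fun w => \big[Num.max/x]_(i <- r | q i) f i w).
Proof.
elim: r => [|i l IH].
  by apply: (eq_measurable_fun (cst x)) => // w _; rewrite big_nil.
pose g w := \big[Num.max/x]_(i <- l | q i) f i w.
apply: (eq_measurable_fun (fun w => if q i then Num.max (f i w) (g w) else g w)).
  by move=> w _; rewrite big_cons.
by case: (boolP (q i)) => [qi|//]; apply: measurable_maxr => //; exact: mf.
Qed.

(** The index set may vary with [w], as do the groups that complete their copy of a hot request. *)
Lemma measurable_bigminr_cond (p : J -> T -> bool) (s : T -> R) :
  measurable_fun setT s -> (forall i, q i -> measurable_fun setT (p i)) ->
  measurable_fun setT (fun w => \big[Num.min/s w]_(i <- r | q i && p i w) f i w).
Proof.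
move=> ms mp; elim: r => [|i l IH].
  by apply: (eq_measurable_fun s) => // w _; rewrite big_nil.
pose g w := \big[Num.min/s w]_(i <- l | q i && p i w) f i w.
apply: (eq_measurable_fun
    (fun w => if q i && p i w then Num.min (f i w) (g w) else g w)).
  by move=> w _; rewrite big_cons.
case: (boolP (q i)) => [qi|_] //=; apply: measurable_fun_ifT => //.
  exact: mp.
by apply: measurable_minr => //; exact: mf.
Qed.

Lemma measurable_bigminr (s : T -> R) : measurable_fun setT s ->
  measurable_fun setT (fun w => \big[Num.min/s w]_(i <- r | q i) f i w).
Proof.
move=> ms; apply: eq_measurable_fun (@measurable_bigminr_cond (fun _ _ => true) s ms _).
  by move=> w _; apply: eq_bigl => i; rewrite andbT.
by move=> i _; exact: measurable_cst.
Qed.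

End MeasurableBigop.

Section MeasurableFifo.
Context d (T : measurableType d) (R : realType).

Lemma measurable_arrival (a : nat -> T -> R) n :
  (forall i, measurable_fun setT (a i)) ->
  measurable_fun setT (fun w => arrival (a^~ w) n).
Proof.
move=> ma; elim: n => [|n IH].
  by apply: (eq_measurable_fun (a 0)) => // w _; rewrite /arrival big_ord1.
apply: (eq_measurable_fun (fun w => arrival (a^~ w) n + a n.+1 w)).
  by move=> w _; rewrite /arrival [RHS]big_ord_recr.
exact: measurable_funD.
Qed.

Context (arr : nat -> T -> R) (svc : nat -> T -> R -> R).
Hypothesis marr : forall n, measurable_fun setT (arr n).
Hypothesis msvc : forall n b, measurable_fun setT b ->
  measurable_fun setT (fun w => svc n w (b w)).

(** Service times depend on a start epoch that is itself random; [msvc] therefore asks for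
    measurability after substituting a measurable epoch, which is what the induction supplies. *)
Lemma measurable_fifo_start n :
  measurable_fun setT (fun w => fifo_start (arr^~ w) (fun i => svc i w) n).
Proof.
elim: n => [|n IH] //=; apply: measurable_maxr => //.
by apply: measurable_funD => //; exact: msvc.
Qed.

Lemma measurable_fifo_departure n :
  measurable_fun setT (fun w => fifo_departure (arr^~ w) (fun i => svc i w) n).
Proof.
have := measurable_fifo_start n => ms.
by apply: measurable_funD => //; exact: msvc.
Qed.

Lemma measurable_fifo_response n :
  measurable_fun setT (fun w => fifo_response (arr^~ w) (fun i => svc i w) n).
Proof. by apply: measurable_funB => //; exact: measurable_fifo_departure. Qed.

End MeasurableFifo.

Lemma prode_const_seq (R : realType) (J : Type) (s : seq J) (x : \bar R) :
  (\prod_(j <- s) x = x ^+ size s)%E.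
Proof.
elim: s => [|j s IH]; first by rewrite big_nil expe0.
by rewrite big_cons IH expeS.
Qed.

(** * Pathwise bounds by two M/G/1 queues *)

Section FairnessFirstBounds.
Context (R : realType) (k : nat) (hot : 'I_k) (lambda lambda_c : R).
Context (V : probability R R) (hV : V `]-oo, 0[%classic = 0%E).
Context d (T : measurableType d) (P : probability T R).
Context (A S : 'I_k -> nat -> {RV P >-> R}) (C : nat -> server k -> {RV P >-> R}).
Hypothesis hff : fairness_first hot lambda lambda_c V A S C.

Local Notation primitive := (('I_k * nat) + (('I_k * nat) + (nat * server k)))%type.

Definition primitives (i : primitive) : {RV P >-> R} :=
  match i with
  | inl (j, n) => A j n
  | inr (inl (j, n)) => S j n
  | inr (inr (n, v)) => C n v
  end.

Lemma primitives_indep : mutually_independent primitives.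
Proof. by case: hff. Qed.

Definition copy n (G : {set server k}) (w : T) : R :=
  copy_time (fun m v => C m v w) n G.

(** The service time if exactly the groups in [Gs] always ran their copies to the end. All recovery
    groups give the lower bound, the pure ones the upper bound. *)
Definition service_min (Gs : {set {set server k}}) n (w : T) : R :=
  \big[Num.min/S hot n w]_(G in Gs) copy n G w.

Local Notation cdf x := (V `]-oo, x]%classic).

Lemma measurable_copy n G : measurable_fun setT (copy n G).
Proof. by apply: (@measurable_bigmaxr _ _ _ _ _ _ (fun v w => C n v w)). Qed.

(* For x < 0 this rests on [hV], because [copy_time] is a maximum with 0. *)
Lemma copy_tail n (G : {set server k}) x : #|G| = 2%N ->
  P [set w | x < copy n G w] = (1 - cdf x ^+ 2)%E.
Proof.
move=> G2.
have -> : [set w | x < copy n G w] = ~` [set w | copy n G w <= x].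
  by apply/seteqP; split=> w /=; rewrite ltNge => /negP.
have mle : measurable [set w | copy n G w <= x].
  by apply: measurable_sublevel; exact: measurable_copy.
rewrite probability_setC//; congr (1 - _)%E.
have [x0|x0] := leP 0 x; last first.
  rewrite (_ : [set w | _] = set0); last first.
    apply/seteqP; split=> w //= /le_lt_trans/(_ x0); apply/negP; rewrite -leNgt.
    exact: bigmax_ge_id.
  rewrite measure0 (_ : cdf x = 0%E) ?expeS ?mul0e//.
  apply/eqP; rewrite eq_le measure_ge0 andbT -hV; apply: le_measure; rewrite ?inE//.
  by move=> y /=; rewrite !in_itv/= => /le_lt_trans; apply.
pose s := [seq inr (inr (n, v)) : primitive | v <- enum G].
have us : uniq s by rewrite map_inj_uniq ?enum_uniq// => u v [].
have prod_s := primitives_indep us (fun=> measurable_itv `]-oo, x]).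
transitivity (P [set w | forall i, i \in s -> `]-oo, x]%classic (primitives i w)]).
  congr (P _); apply/seteqP; split=> w /=.
    move=> /bigmax_leP[_ H] i /mapP[v vG ->]; rewrite in_itv/=.
    by apply: H; rewrite mem_enum in vG.
  move=> H; apply/bigmax_leP; split=> // v vG.
  have := H (inr (inr (n, v))); rewrite in_itv/=; apply.
  by apply/mapP; exists v; rewrite ?mem_enum.
apply: etrans prod_s _; rewrite big_map -[in RHS]G2 cardE -prode_const_seq.
by apply: eq_bigr => v _; case: hff => _ _ _ /(_ n v _ (measurable_itv `]-oo, x])).
Qed.

Lemma measurable_service_min Gs n : measurable_fun setT (service_min Gs n).
Proof.
by apply: measurable_bigminr => // G _; exact: measurable_copy.
Qed.

(** The minimum exceeds [x] when the systematic copy and every group copy do. As groups are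
    disjoint, these events depend on disjoint blocks of primitives, and their probabilities
    multiply. *)
Lemma service_min_tail (Gs : {set {set server k}}) n x : Gs \subset recovery_groups hot ->
  P [set w | x < service_min Gs n w] = S_tail V #|Gs| x.
Proof.
move=> sGs.
(* [None] stands for the systematic copy, [Some G] for the copy at [G]. *)
pose K (j : option {set server k}) : set primitive := match j with
  | None => [set inr (inl (hot, n))]
  | Some G => [set i | exists2 v, v \in G & i = inr (inr (n, v))] end.
pose E (j : option {set server k}) : set T := match j with
  | None => [set w | x < S hot n w]
  | Some G => [set w | x < copy n G w] end.
pose s := None :: [seq Some G | G <- enum Gs].
have -> : [set w | x < service_min Gs n w] = [set w | forall j, j \in s -> E j w].
  apply/seteqP; split=> w /=.
    move=> /bigmin_gtP[H0 H] j; rewrite inE => /orP[/eqP ->//|/mapP[G GG ->]].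
    by apply: H; rewrite mem_enum in GG.
  move=> H; apply/bigmin_gtP; split.
    by have := H None; apply; rewrite inE eqxx.
  move=> G GG; have := H (Some G); apply; rewrite inE/=; apply/mapP; exists G => //.
  by rewrite mem_enum.
rewrite (indep_blocks primitives_indep (K := K)).
- rewrite /s big_cons big_map /S_tail; congr (_ * _)%E.
    have [_ _ /(_ hot n) lS _] := hff; rewrite -lS//; congr (P _).
    by apply/seteqP; split=> w /=; rewrite in_itv/= andbT.
  rewrite cardE -prode_const_seq; apply: eq_big_seq => G.
  rewrite mem_enum => /(fintype.subsetP sGs) GP.
  exact/copy_tail/card_recovery_group/GP.
- rewrite /= map_inj_uniq ?enum_uniq ?andbT; last by move=> G G' [].
  by apply/mapP => -[].
- move=> [G|] [G'|]; rewrite !inE /s//= => Gs1 Gs2 GG'; rewrite -subset0 => i /=.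
  + case=> [[v vG ->]] [u uG' [E0]]; move: uG'; rewrite -E0 => vG'.
    move: Gs1 Gs2; rewrite !(mem_map Some_inj) !mem_enum.
    move=> /(fintype.subsetP sGs) GP /(fintype.subsetP sGs) GP'.
    have /finset.trivIsetP /(_ _ _ GP GP') := recovery_groups_trivIset hot.
    have GG'' : G != G' by apply: contra GG' => /eqP ->.
    by move=> /(_ GG'') /pred0P /(_ v)/=; rewrite vG vG'.
  + by case=> [[v _ ->]].
  + by case=> ->; case.
move=> j js.
case: j js => [G|] _;
  (* Measurability is proved in the sigma-algebra of the block, not in the ambient one. *)
  apply: (@measurable_superlevel _ (g_sigma_algebraType (cylinders primitives _))).
  apply: (@measurable_bigmaxr _ (g_sigma_algebraType (cylinders primitives (K (Some G))))
    _ _ _ _ (fun v w => C n v w)) => v vG.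
  by apply: (@measurable_coord _ _ _ _ _ primitives _ (inr (inr (n, v)))); exists v.
exact: (@measurable_coord _ _ _ _ _ primitives _ (inr (inl (hot, n)))).
Qed.

Definition service_min_RV Gs n : {RV P >-> R} :=
  mfun_Sub (mem_set (measurable_service_min Gs n)).

(** The [n]-th service time reads only primitives of hot request [n] other than its interarrival
    time; these blocks are disjoint from one another and from the arrivals. *)
Lemma service_min_MG1 (Gs : {set {set server k}}) : Gs \subset recovery_groups hot ->
  MG1 lambda (S_tail V #|Gs|) (A hot) (service_min_RV Gs).
Proof.
move=> sGs; split=> [|n|n x]; last exact: service_min_tail; last first.
  by case: hff => _ /(_ hot n) + _ _; rewrite eqxx.
pose K (j : nat + nat) : set primitive := match j with
  | inl n => [set inl (hot, n)]
  | inr n => [set i | i = inr (inl (hot, n)) \/ exists v, i = inr (inr (n, v))] end.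
move=> s B us mB.
apply: (indep_blocks primitives_indep (K := K)) => //.
  move=> [m|m] [n|n] _ _ mn; rewrite -subset0 => i [] /=.
  - by move=> -> [] E0; rewrite E0 eqxx in mn.
  - by move=> -> []// [].
  - by move=> [->|[v ->]].
  - by move=> [->|[v ->]] [E0|[u E0]]; case: E0 mn => // ->; rewrite eqxx.
move=> [n|n] _ /=.
  have := @measurable_coord _ _ _ P _ primitives (K (inl n)) (inl (hot, n)) erefl.
  by move=> /measurable_preimageT; apply.
have : measurable_fun (setT : set (g_sigma_algebraType (cylinders primitives (K (inr n)))))
    (service_min Gs n).
  apply: measurable_bigminr => [G _|].
    apply: (@measurable_bigmaxr _ (g_sigma_algebraType (cylinders primitives (K (inr n))))
      _ _ _ _ (fun v w => C n v w)) => v vG.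
    by apply: (@measurable_coord _ _ _ _ _ primitives _ (inr (inr (n, v)))); right; exists v.
  by apply: (@measurable_coord _ _ _ _ _ primitives _ (inr (inl (hot, n)))); left.
by move=> /measurable_preimageT; apply.
Qed.

Definition hot_svc n w b :=
  hot_service hot (fun i m => A i m w) (fun i m => S i m w) (fun m v => C m v w) n b.

Lemma hot_service_ge n w b : service_min (recovery_groups hot) n w <= hot_svc n w b.
Proof.
apply: le_bigmin => [|G /andP[GP _]]; first exact: bigmin_le_id.
exact: bigmin_le_cond.
Qed.

(** For a pure group, being idle and keeping the copy hold vacuously at every epoch, so the minimum
    on the left runs over at least the pure groups. *)
Lemma hot_service_le n w b : hot_svc n w b <= service_min (pure_groups hot) n w.
Proof.
apply: le_bigmin => [|G]; first exact: bigmin_le_id.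
rewrite inE => /andP[GP /forallP pG]; apply: bigmin_le_cond.
rewrite GP/=; apply/asboolP; split=> [j jh jG|[j [m [jh jG _]]]];
  by have := pG j; rewrite jh jG.
Qed.

Lemma ff_download_ge n w :
  MG1_response (A hot) (service_min_RV (recovery_groups hot)) n w <=
  ff_download hot A S C hot n w.
Proof.
rewrite /ff_download /download_time eqxx.
by apply: fifo_response_le => i b b'; exact: hot_service_ge.
Qed.

Lemma ff_download_le n w :
  ff_download hot A S C hot n w <=
  MG1_response (A hot) (service_min_RV (pure_groups hot)) n w.
Proof.
rewrite /ff_download /download_time eqxx.
by apply: fifo_response_le => i b b'; exact: hot_service_le.
Qed.

(* [P] is monotone on measurable sets only, so the pathwise bounds above say
   nothing about probabilities until the download time is known to be
   measurable. *)
Lemma measurable_hot_service n (b : T -> R) : measurable_fun setT b ->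
  measurable_fun setT (fun w => hot_svc n w (b w)).
Proof.
move=> mb; apply: measurable_bigminr_cond => // G _; first exact: measurable_copy.
apply: (measurable_fun_bool true).
rewrite setTI.
(* The two ways in which request [m] for symbol [j] spoils the copy at [G]: being in service at the
   launch, or arriving during the copy. The condition on [G] thus becomes a countable
   intersection. *)
pose bad j m w :=
  ((fifo_start (arrival (A j ^~ w)) (fun i _ => S j i w) m <= b w) &&
    (b w < fifo_departure (arrival (A j ^~ w)) (fun i _ => S j i w) m)) ||
  ((b w < arrival (A j ^~ w) m) && (arrival (A j ^~ w) m < b w + C n (systematic j) w)).
rewrite (_ : _ @^-1` _ = [set w | forall j,
  j \in [seq j <- enum 'I_k | (j != hot) && (systematic j \in G)] ->
  (\bigcap_m (bad j m @^-1` [set false])) w]); last first.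
  apply/seteqP; split=> w /=.
    move=> /asboolP[idle nrem] j; rewrite mem_filter => /andP[/andP[jh jG] _] m _ /=.
    apply/negbTE; rewrite negb_or; apply/andP; split; apply/negP => H.
      by apply: (idle j jh jG); exists m.
    by apply: nrem; exists j, m.
  move=> H; apply/asboolP; split.
    move=> j jh jG [m Hm]; have := H j; rewrite mem_filter jh jG mem_enum => /(_ isT m I).
    by rewrite /= /bad Hm.
  move=> [j [m [jh jG Hm]]]; have := H j; rewrite mem_filter jh jG mem_enum => /(_ isT m I).
  by rewrite /= /bad Hm orbT.
apply: measurable_forall_seq => j _; apply: bigcapT_measurable => m.
have ma i : measurable_fun setT (fun w => arrival (A j ^~ w) i).
  by apply: (@measurable_arrival _ _ _ (fun i w => A j i w)) => l.
have mst := @measurable_fifo_start _ _ _ (fun i w => arrival (A j ^~ w) i)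
  (fun i w _ => S j i w) ma (fun _ _ _ => measurable_funPT _) m.
have mdp := @measurable_fifo_departure _ _ _ (fun i w => arrival (A j ^~ w) i)
  (fun i w _ => S j i w) ma (fun _ _ _ => measurable_funPT _) m.
apply: measurable_preimageT => //; apply: measurable_or; apply: measurable_and.
- exact: measurable_fun_ler.
- exact: measurable_fun_ltr.
- exact: measurable_fun_ltr.
- by apply: measurable_fun_ltr => //; exact: measurable_funD.
Qed.

Lemma measurable_ff_download n : measurable_fun setT (ff_download hot A S C hot n).
Proof.
rewrite /ff_download /download_time eqxx.
apply: (@measurable_fifo_response _ _ _ (fun i w => arrival (A hot ^~ w) i) hot_svc).
- by move=> i; apply: (@measurable_arrival _ _ _ (fun i w => A hot i w)).
- by move=> i b; exact: measurable_hot_service.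
Qed.

End FairnessFirstBounds.

(** The order of distribution functions survives the limit at common continuity points, which are
    dense; right continuity extends it to all points. *)
Lemma limit_law_le_integral d (T : measurableType d) d' (T' : measurableType d')
  (R : realType) (P : probability T R) (P' : probability T' R)
  (Y : nat -> T -> R) (Y' : nat -> T' -> R) (mu mu' : probability (\bar R) R) :
  limit_law P Y mu -> limit_law P' Y' mu' ->
  (forall n (x : R), (P' [set w | (Y' n w <= x)%R] <= P [set w | (Y n w <= x)%R])%E) ->
  (\int[mu]_y y <= \int[mu']_y y)%E.
Proof.
move=> lY lY' YY'; apply: le_integral_cdf; apply: cdf_le_of_dense => x y xy.
have [z [xzy muz mu'z]] := common_continuity_point mu mu' xy; exists z => //.
rewrite -(cvg_lim _ (lY z muz))// -(cvg_lim _ (lY' z mu'z))//.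
apply: lee_lim; [by apply/cvg_ex; eexists; exact: lY'|
  by apply/cvg_ex; eexists; exact: lY|exact: nearW].
Qed.

Theorem theorem8 (R : realType) (k : nat) (hot : 'I_k) (t : nat)
  (ht : t = (2 ^ (k - 1) - 1)%N)
  (lambda lambda_c : R) (hlambda : 0 < lambda) (hlambda_c : 0 < lambda_c)
  (V : probability R R) (hV : V `]-oo, 0[%classic = 0%E)
  (d : measure_display) (T : measurableType d) (P : probability T R)
  (A S : 'I_k -> nat -> {RV P >-> R}) (C : nat -> server k -> {RV P >-> R})
  (hff : fairness_first hot lambda lambda_c V A S C)
  (hstable : forall j : 'I_k, stable P (ff_download hot A S C j))
  (dU : measure_display) (TU : measurableType dU) (PU : probability TU R)
  (AU SU : nat -> {RV PU >-> R})
  (hU : MG1 lambda (S_tail V (t - trunc_log 2 (t + 1))) AU SU)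
  (dL : measure_display) (TL : measurableType dL) (PL : probability TL R)
  (AL SL : nat -> {RV PL >-> R})
  (hL : MG1 lambda (S_tail V t) AL SL) :
  exists m mU mL : \bar R,
    [/\ steady_state_mean P (ff_download hot A S C hot) m,
        steady_state_mean PU (MG1_response AU SU) mU,
        steady_state_mean PL (MG1_response AL SL) mL
      & (mL <= m <= mU)%E].
Proof.
(* The hot limit law comes from stability, those of the M/G/1 queues from the reversal argument. *)
have [mu [lmu _]] := hstable hot.
have [muU cU] := MG1_response_cvg hU.
have [muL cL] := MG1_response_cvg hL.
have lU : limit_law PU (MG1_response AU SU) muU by move=> x _; exact: cU.
have lL : limit_law PL (MG1_response AL SL) muL by move=> x _; exact: cL.
exists (\int[mu]_y y)%E, (\int[muU]_y y)%E, (\int[muL]_y y)%E; split.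
- by exists mu.
- by exists muU.
- by exists muL.
have mff n (x : R) : measurable [set w | ff_download hot A S C hot n w <= x].
  by apply: measurable_sublevel; exact: measurable_ff_download.
have mMG1 Gs n (x : R) :
    measurable [set w | MG1_response (A hot) (service_min_RV hot S C Gs) n w <= x].
  apply: measurable_sublevel.
  apply: (@measurable_fifo_response _ _ _ (fun i w => arrival (A hot ^~ w) i)
    (fun i w _ => service_min_RV hot S C Gs i w)) => //.
  by move=> i; apply: (@measurable_arrival _ _ _ (fun i w => A hot i w)).
have ray (x : R) : measurable [set y : R | y <= x].
  by apply: measurable_sublevel; exact: measurable_id.
apply/andP; split.
  apply: (limit_law_le_integral lL lmu) => n x.
  (* The lower queue is realized on [P] with the hot arrivals and all groups; the given realization
     has the same response laws. *)
  have hL' := service_min_MG1 hV hff (fintype.subxx (recovery_groups hot)).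
  rewrite card_recovery_groups -ht in hL'.
  rewrite (MG1_response_law n hL hL' (ray x)).
  apply: le_measure; rewrite ?inE//= => w /=; apply: le_trans.
  exact: ff_download_ge.
have sp : pure_groups hot \subset recovery_groups hot.
  by apply/fintype.subsetP => G; rewrite inE => /andP[].
apply: (limit_law_le_integral lmu lU) => n x.
(* Likewise, the upper queue is realized on [P] with the pure groups alone. *)
have hU' := service_min_MG1 hV hff sp.
rewrite (card_pure_groups hot ht) in hU'.
rewrite (MG1_response_law n hU hU' (ray x)).
apply: le_measure; rewrite ?inE//= => w /=; apply: le_trans.
exact: ff_download_le.
Qed.
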